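(* Consider the dynamical system $(C^*(G,P),\alpha)$ and take $\beta\in\mathbb{R}$. \begin{enumerate} \item[(a)] Every KMS$_\beta$ state of $(C^*(G,P),\alpha)$ factors through the quotient by the ideal generated by $1-T_bT_b^*$. \item[(b)] If $\beta<\ln d$, then $(C^*(G,P),\alpha)$ has no KMS$_\beta$ states. \item[(c)] Let $I$ be the ideal of $C^*(G,P)$ generated by the element $1-\sum_{j=0}^{d-1}T_{b^ja}T_{b^ja}^*$. Then a KMS$_\beta$ state factors through the quotient $\mathcal{O}(G,P):=C^*(G,P)/I$ if and only if $\beta=\ln d$. \end{enumerate}
   Context: Fix positive integers $c,d$. $G=\mathrm{BS}(c,d)=\langle a,b: ab^c=b^da\rangle$ is the Baumslag-Solitar group, $P$ is the submonoid of $G$ generated by $a$ and $b$, and $\theta:G\to\mathbb{Z}$ is the homomorphism with $\theta(a)=1$, $\theta(b)=0$. Ideals are closed and two-sided. Order: for $g,h\in G$, $g\leq h$ means $g^{-1}h\in P$. It is known (Spielberg) that $(G,P)$ is quasi-lattice ordered: $P\cap P^{-1}=\{e\}$, and every pair $g,h\in G$ with a common upper bound in $P$ has a least upper bound $g\vee h$ in $P$. Write $g\vee h<\infty$ if a common upper bound in $P$ exists and $g\vee h=\infty$ otherwise. A Nica-covariant representation of $P$ is a map $x\mapsto S_x$ of $P$ into the isometries of a unital $C^*$-algebra with $S_e=1$, $S_xS_y=S_{xy}$, and $S_xS_x^*S_yS_y^*=S_{x\vee y}S_{x\vee y}^*$ if $x\vee y<\infty$ and $=0$ if $x\vee y=\infty$.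 $C^*(G,P)$ is the $C^*$-algebra generated by a universal Nica-covariant representation $T:P\to C^*(G,P)$; it is the closed linear span of $\{T_xT_y^*:x,y\in P\}$. The dynamics $\alpha:\mathbb{R}\to\mathrm{Aut}\,C^*(G,P)$ is given by $\alpha_t(T_x)=e^{it\theta(x)}T_x$. For $\beta\in\mathbb{R}$, a state $\psi$ of $C^*(G,P)$ is a KMS$_\beta$ state if and only if $\psi((T_xT_y^* )(T_pT_q^* ))=e^{-\beta(\theta(x)-\theta(y))}\psi((T_pT_q^* )(T_xT_y^* ))$ for all $x,y,p,q\in P$ and, when $\beta=0$, $\psi$ is in addition $\alpha$-invariant. *)

(* Defs.v *)
From HB Require Import structures.
From mathcomp Require Import all_boot all_order all_algebra.
From mathcomp Require Import all_classical all_reals all_analysis.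
From mathcomp Require Import complex.

Set Implicit Arguments.
Unset Strict Implicit.
Unset Printing Implicit Defensive.

Import Order.TTheory GRing.Theory Num.Theory.
Import numFieldNormedType.Exports.

Local Open Scope classical_set_scope.
Local Open Scope ring_scope.
Local Open Scope quotient_scope.
Local Open Scope complex_scope.

(* A letter (g, e) is the generator a if g = true and b if g = false,
   inverted if e = true. *)
Definition letter : Type := (bool * bool)%type.
Definition letter_inv (l : letter) : letter := (l.1, ~~ l.2).
Definition letter_a : letter := (true, false).
Definition letter_b : letter := (false, false).

Inductive BS_cong (c d : nat) : seq letter -> seq letter -> Prop :=
| BS_cong_refl u : BS_cong c d u u
| BS_cong_sym u v : BS_cong c d u v -> BS_cong c d v u
| BS_cong_trans u v w : BS_cong c d u v -> BS_cong c d v w -> BS_cong c d u w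
| BS_cong_cat u u' v v' :
    BS_cong c d u u' -> BS_cong c d v v' -> BS_cong c d (u ++ v) (u' ++ v')
| BS_cong_cancel l : BS_cong c d [:: l; letter_inv l] [::]
| BS_cong_relator :
    BS_cong c d (letter_a :: nseq c letter_b) (rcons (nseq d letter_b) letter_a).

Definition BS_rel (c d : nat) : rel (seq letter) :=
  fun u v => `[< BS_cong c d u v >].

Lemma BS_rel_refl c d : reflexive (BS_rel c d).
Proof. by move=> u; apply/asboolP; exact: BS_cong_refl. Qed.

Lemma BS_rel_sym c d : symmetric (BS_rel c d).
Proof. by move=> u v; apply/asboolP/asboolP => h; exact: BS_cong_sym. Qed.

Lemma BS_rel_trans c d : transitive (BS_rel c d).
Proof.
by move=> v u w /asboolP h /asboolP k; apply/asboolP; exact: BS_cong_trans h k.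
Qed.

Canonical BS_equiv c d :=
  EquivRel (BS_rel c d) (@BS_rel_refl c d) (@BS_rel_sym c d) (@BS_rel_trans c d).

Definition BS (c d : nat) : Type := {eq_quot (BS_equiv c d)}.

HB.instance Definition _ c d := Choice.on (BS c d).
HB.instance Definition _ c d := EqQuotient.on (BS c d).

Section BaumslagSolitarGroup.
Variables c d : nat.
Implicit Types (u v : seq letter) (x y z : BS c d).

Definition BS_word u : BS c d := \pi_(BS c d) u.

Lemma BS_wordP u v : BS_word u = BS_word v <-> BS_cong c d u v.
Proof.
split; first by move=> /eqmodP/asboolP.
by move=> h; apply/eqmodP/asboolP.
Qed.

Lemma BS_cong_repr u : BS_cong c d (repr (BS_word u)) u.
Proof. by apply/BS_wordP; rewrite /BS_word reprK. Qed.

Lemma BS_word_repr x : BS_word (repr x) = x.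
Proof. exact: reprK. Qed.

Definition word_inv u : seq letter := rev (map letter_inv u).

Definition BS_one : BS c d := BS_word [::].
Definition BS_mul x y : BS c d := BS_word (repr x ++ repr y).
Definition BS_inv x : BS c d := BS_word (word_inv (repr x)).

Lemma BS_mul_word u v : BS_mul (BS_word u) (BS_word v) = BS_word (u ++ v).
Proof. by apply/BS_wordP; apply: BS_cong_cat; exact: BS_cong_repr. Qed.

Lemma BS_mulA : associative BS_mul.
Proof.
move=> x y z; rewrite -(BS_word_repr x) -(BS_word_repr y) -(BS_word_repr z).
by rewrite !BS_mul_word catA.
Qed.

Lemma BS_mul1 : left_id BS_one BS_mul.
Proof. by move=> x; rewrite -(BS_word_repr x) BS_mul_word. Qed.

Lemma BS_mulr1 : right_id BS_one BS_mul.
Proof. by move=> x; rewrite -(BS_word_repr x) BS_mul_word cats0. Qed.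

Lemma BS_cong_mulV u : BS_cong c d (u ++ word_inv u) [::].
Proof.
elim: u => [|l u ih]; first exact: BS_cong_refl.
have -> : (l :: u) ++ word_inv (l :: u) =
    [:: l] ++ ((u ++ word_inv u) ++ [:: letter_inv l]).
  by rewrite /word_inv map_cons rev_cons -cats1 -!catA.
apply: BS_cong_trans (BS_cong_cancel c d l).
apply: (BS_cong_cat (BS_cong_refl c d [:: l])).
exact: (BS_cong_cat ih (BS_cong_refl c d [:: letter_inv l])).
Qed.

Lemma word_invK : involutive word_inv.
Proof.
move=> u; rewrite /word_inv map_rev revK -map_comp -[RHS]map_id.
by apply: eq_map => -[g e]; rewrite /letter_inv /= negbK.
Qed.

Lemma BS_mulrV : right_inverse BS_one BS_inv BS_mul.
Proof.
move=> x; rewrite -{1}(BS_word_repr x) BS_mul_word.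
by apply/BS_wordP; exact: BS_cong_mulV.
Qed.

Lemma BS_mulV : left_inverse BS_one BS_inv BS_mul.
Proof.
move=> x; rewrite -{2}(BS_word_repr x) BS_mul_word.
by apply/BS_wordP; rewrite -{2}(word_invK (repr x)); exact: BS_cong_mulV.
Qed.

HB.instance Definition _ :=
  isGroup.Build (BS c d) BS_mulA BS_mul1 BS_mulr1 BS_mulV BS_mulrV.

Definition BSa : BS c d := BS_word [:: letter_a].
Definition BSb : BS c d := BS_word [:: letter_b].

Inductive BSpos : set (BS c d) :=
| BSpos1 : BSpos 1%g
| BSpos_a : BSpos BSa
| BSpos_b : BSpos BSb
| BSposM x y : BSpos x -> BSpos y -> BSpos (x * y)%g.

Definition BSle x y : Prop := BSpos (x^-1 * y)%g.

Definition BSub x y z : Prop := [/\ BSpos z, BSle x z & BSle y z].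

(* z = x \vee y; by antisymmetry of BSle such a z is unique. *)
Definition BSlub x y z : Prop := BSub x y z /\ forall w, BSub x y w -> BSle z w.

Definition letter_height (l : letter) : int :=
  if l.1 then (if l.2 then -1 else 1) else 0.

Definition word_height u : int := \sum_(l <- u) letter_height l.

Definition BStheta x : int := word_height (repr x).

Lemma word_height_cong u v : BS_cong c d u v -> word_height u = word_height v.
Proof.
have h0 n : word_height (nseq n letter_b) = 0.
  by rewrite /word_height big1_seq // => l /andP[_ /nseqP[-> _]].
elim=> //.
- by move=> {}u {}v w _ -> _ ->.
- by move=> {}u u' {}v v' _ + _; rewrite /word_height !big_cat /= => -> ->.
- by move=> [[] []]; rewrite /word_height !big_cons big_nil.
- rewrite -cats1 /word_height big_cons big_cat -/(word_height _) /=.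
  by rewrite -/(word_height _) !h0 /word_height big_seq1 addr0 add0r.
Qed.

Lemma BStheta_word u : BStheta (BS_word u) = word_height u.
Proof. exact/word_height_cong/BS_cong_repr. Qed.

Lemma BSthetaM x y : BStheta (x * y)%g = BStheta x + BStheta y.
Proof. by rewrite BStheta_word /word_height big_cat. Qed.

Lemma BStheta_a : BStheta BSa = 1.
Proof. by rewrite BStheta_word /word_height big_seq1. Qed.

Lemma BStheta_b : BStheta BSb = 0.
Proof. by rewrite BStheta_word /word_height big_seq1. Qed.

Lemma BS_relation : (BSa * BSb ^+ c = BSb ^+ d * BSa)%g.
Proof.
have bX n : (BSb ^+ n)%g = BS_word (nseq n letter_b).
  by elim: n => // n ih; rewrite expgS ih [LHS]BS_mul_word.
rewrite !bX [LHS]BS_mul_word [RHS]BS_mul_word cats1.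
by apply/BS_wordP; exact: BS_cong_relator.
Qed.

End BaumslagSolitarGroup.

Arguments BSa {c d}.
Arguments BSb {c d}.
Arguments BSpos {c d}.

(* The norm is a field of the structure, and not the one of a normedModType:
   Num.NumDomain is already the join of rings and normed groups, so the
   hierarchy does not admit a join of GRing.Algebra and NormedModule.  The
   carrier of an algType is nonzero: the zero algebra is excluded. *)
HB.mixin Record isCStarAlgebra (R : realType) A of GRing.Algebra R[i] A := {
  star : A -> A;
  starK : involutive star;
  starD : {morph star : x y / x + y};
  starZ : forall (k : R[i]) (x : A), star (k *: x) = k^* *: star x;
  starM : forall x y : A, star (x * y) = star y * star x;
  cnorm : A -> R;
  cnorm_ge0 : forall x : A, 0 <= cnorm x;
  cnorm0_eq0 : forall x : A, cnorm x = 0 -> x = 0;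
  cnormD : forall x y : A, cnorm (x + y) <= cnorm x + cnorm y;
  cnormZ : forall (k : R[i]) (x : A),
    (cnorm (k *: x))%:C = `|k| * (cnorm x)%:C;
  cnormM : forall x y : A, cnorm (x * y) <= cnorm x * cnorm y;
  cstar_norm : forall x : A, cnorm (star x * x) = cnorm x ^+ 2;
  cnorm_complete : forall u : nat -> A,
    (forall e : R, 0 < e -> exists N : nat, forall m n : nat,
      (N <= m)%N -> (N <= n)%N -> cnorm (u m - u n) < e) ->
    exists l : A, cnorm (u n - l) @[n --> \oo] --> (0 : R)
}.

#[short(type="cstarAlgType")]
HB.structure Definition CStarAlgebra (R : realType) :=
  {A of isCStarAlgebra R A & GRing.Algebra R[i] A}.

Definition cstar_closed (R : realType) (A : cstarAlgType R) (D : set A) : Prop :=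
  forall x : A, (forall e : R, 0 < e -> exists2 y, D y & cnorm (x - y) < e) -> D x.

Definition star_hom (R : realType) (A B : cstarAlgType R)
    (f : {lrmorphism A -> B}) : Prop := {morph f : x / star x}.

Record closed_ideal (R : realType) (A : cstarAlgType R) := ClosedIdeal {
  ideal_set :> set A;
  ideal_0 : ideal_set 0;
  ideal_D : forall x y, ideal_set x -> ideal_set y -> ideal_set (x + y);
  ideal_Ml : forall x y, ideal_set y -> ideal_set (x * y);
  ideal_Mr : forall x y, ideal_set x -> ideal_set (x * y);
  ideal_closed : cstar_closed ideal_set
}.

Section Ideals.
Variables (R : realType) (A : cstarAlgType R).
Implicit Types (I : closed_ideal A) (k : R[i]).

Definition ideal_gen_set (q : A) : set A :=
  [set x | forall I, ideal_set I q -> ideal_set I x].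

Fact ideal_gen_0 q : ideal_gen_set q 0.
Proof. by move=> I _; exact: ideal_0. Qed.

Fact ideal_gen_D q x y :
  ideal_gen_set q x -> ideal_gen_set q y -> ideal_gen_set q (x + y).
Proof. by move=> hx hy I hq; apply: ideal_D; [exact: hx|exact: hy]. Qed.

Fact ideal_gen_Ml q x y : ideal_gen_set q y -> ideal_gen_set q (x * y).
Proof. by move=> hy I hq; apply: ideal_Ml; exact: hy. Qed.

Fact ideal_gen_Mr q x y : ideal_gen_set q x -> ideal_gen_set q (x * y).
Proof. by move=> hx I hq; apply: ideal_Mr; exact: hx. Qed.

Fact ideal_gen_closed q : cstar_closed (ideal_gen_set q).
Proof.
move=> x hx I hq; apply: ideal_closed => e /hx[y hy xy].
by exists y => //; exact: hy.
Qed.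

Definition ideal_gen (q : A) : closed_ideal A :=
  ClosedIdeal (@ideal_gen_0 q) (@ideal_gen_D q) (@ideal_gen_Ml q)
    (@ideal_gen_Mr q) (@ideal_gen_closed q).

Definition ideal_pred I : {pred A} := fun x => `[< ideal_set I x >].

Fact ideal_predP I x : reflect (ideal_set I x) (x \in ideal_pred I).
Proof. exact: asboolP. Qed.

Fact ideal_zmod_closed I : zmod_closed (ideal_pred I).
Proof.
split; first exact/ideal_predP/ideal_0.
move=> x y /ideal_predP hx /ideal_predP hy; apply/ideal_predP.
by apply: ideal_D => //; rewrite -mulN1r; exact: ideal_Ml.
Qed.

HB.instance Definition _ I :=
  GRing.isZmodClosed.Build A (ideal_pred I) (ideal_zmod_closed I).

Definition ideal_quotient I : Type := Quotient.quot (ideal_pred I).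

HB.instance Definition _ I := GRing.Zmodule.on (ideal_quotient I).

Definition ideal_pi I (x : A) : ideal_quotient I :=
  \pi_(Quotient.quot (ideal_pred I)) x.

Lemma ideal_piP I x y : ideal_pi I x = ideal_pi I y <-> ideal_set I (x - y).
Proof.
split=> [/eqP|] h; first by apply/ideal_predP; rewrite Quotient.idealrBE.
by apply/eqP; rewrite -Quotient.idealrBE; exact/ideal_predP.
Qed.

Lemma ideal_piD I : {morph ideal_pi I : x y / x + y}.
Proof. by move=> x y; rewrite /ideal_pi piE. Qed.

Lemma ideal_pi_repr I (u : ideal_quotient I) :
  ideal_pi I (repr (u : Quotient.quot (ideal_pred I))) = u.
Proof. exact: reprK. Qed.

Definition ideal_quotient_scale I k (u : ideal_quotient I) : ideal_quotient I :=
  ideal_pi I (k *: repr (u : Quotient.quot (ideal_pred I))).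

Lemma ideal_piZ I k x :
  ideal_pi I (k *: x) = ideal_quotient_scale k (ideal_pi I x).
Proof.
apply/ideal_piP; rewrite -scalerBr -mulr_algl; apply: ideal_Ml.
by apply/ideal_piP; rewrite ideal_pi_repr.
Qed.

Fact ideal_quotient_scaleA I k l (u : ideal_quotient I) :
  ideal_quotient_scale k (ideal_quotient_scale l u) =
  ideal_quotient_scale (k * l) u.
Proof. by rewrite -(ideal_pi_repr u) -!ideal_piZ scalerA. Qed.

Fact ideal_quotient_scale1 I : left_id 1 (@ideal_quotient_scale I).
Proof. by move=> u; rewrite -(ideal_pi_repr u) -ideal_piZ scale1r. Qed.

Fact ideal_quotient_scaleDr I :
  right_distributive (@ideal_quotient_scale I) +%R.
Proof.
move=> k u v; rewrite -(ideal_pi_repr u) -(ideal_pi_repr v).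
by rewrite -ideal_piD -!ideal_piZ -ideal_piD scalerDr.
Qed.

Fact ideal_quotient_scaleDl I (u : ideal_quotient I) :
  {morph (@ideal_quotient_scale I)^~ u : k l / k + l}.
Proof.
by move=> k l; rewrite -(ideal_pi_repr u) -!ideal_piZ -ideal_piD scalerDl.
Qed.

HB.instance Definition _ I :=
  GRing.Zmodule_isLmodule.Build R[i] (ideal_quotient I)
    (@ideal_quotient_scaleA I) (@ideal_quotient_scale1 I)
    (@ideal_quotient_scaleDr I) (@ideal_quotient_scaleDl I).

(* psi factors through the quotient map A -> A / I; when psi is a state, phi is
   automatically positive and unital. *)
Definition factors_through I (psi : {scalar A}) : Prop :=
  exists phi : {scalar (ideal_quotient I)}, forall x : A, psi x = phi (ideal_pi I x).

End Ideals.

(* The last two clauses say that the operator norm of psi is 1. *)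
Definition is_state (R : realType) (A : cstarAlgType R) (psi : {scalar A}) : Prop :=
  [/\ forall x : A, 0 <= psi (star x * x),
      forall x : A, `|psi x| <= (cnorm x)%:C &
      forall M : R, (forall x : A, `|psi x| <= (M * cnorm x)%:C) -> 1 <= M].

Section NicaCovariance.
Variables (R : realType) (c d : nat).
Local Notation G := (BS c d).

(* Representations of P are maps on all of G of which only the values on P are
   used. *)
Definition nica_covariant (B : cstarAlgType R) (S : G -> B) : Prop :=
  [/\ forall x, BSpos x -> star (S x) * S x = 1,
      S 1%g = 1,
      forall x y, BSpos x -> BSpos y -> S (x * y)%g = S x * S y,
      forall x y z, BSpos x -> BSpos y -> BSlub x y z ->
        S x * star (S x) * (S y * star (S y)) = S z * star (S z) &
      forall x y, BSpos x -> BSpos y -> ~ (exists z, BSub x y z) ->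
        S x * star (S x) * (S y * star (S y)) = 0].

Definition cstar_subalgebra (A : cstarAlgType R) (D : set A) : Prop :=
  [/\ D 1,
      forall (k : R[i]) x y, D x -> D y -> D (k *: x + y),
      forall x y, D x -> D y -> D (x * y),
      forall x, D x -> D (star x) &
      cstar_closed D].

(* (A, T) is C*(G, P) with its universal representation, characterised up to
   isomorphism; uniqueness of phi follows from CGP_generated. *)
Record is_CGP (A : cstarAlgType R) (T : G -> A) : Prop := IsCGP {
  CGP_nica : nica_covariant T;
  CGP_generated : forall D : set A, cstar_subalgebra D ->
    (forall x, BSpos x -> D (T x)) -> D = setT;
  CGP_universal : forall (B : cstarAlgType R) (S : G -> B), nica_covariant S ->
    exists phi : {lrmorphism A -> B},
      star_hom phi /\ forall x, BSpos x -> phi (T x) = S x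
}.

Definition cis (s : R) : R[i] := cos s +i* sin s.

(* Each alpha t is bijective, with inverse alpha (- t), by dynamics_0 and
   dynamics_D. *)
Record is_dynamics (A : cstarAlgType R) (T : G -> A)
    (alpha : R -> {lrmorphism A -> A}) : Prop := IsDynamics {
  dynamics_star : forall t, star_hom (alpha t);
  dynamics_0 : forall X, alpha 0 X = X;
  dynamics_D : forall s t X, alpha (s + t) X = alpha s (alpha t X);
  dynamics_cont : forall X s,
    cnorm (alpha t X - alpha s X) @[t --> s] --> (0 : R);
  dynamics_T : forall t x, BSpos x ->
    alpha t (T x) = cis (t * (BStheta x)%:~R) *: T x
}.

(* The KMS condition on the spanning elements T_x T_y^*, which for beta = 0 is
   supplemented by alpha-invariance. *)
Definition is_KMS (A : cstarAlgType R) (T : G -> A)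
    (alpha : R -> {lrmorphism A -> A}) (beta : R) (psi : {scalar A}) : Prop :=
  [/\ is_state psi,
      forall x y p q, BSpos x -> BSpos y -> BSpos p -> BSpos q ->
        psi ((T x * star (T y)) * (T p * star (T q))) =
        (expR (- beta * (BStheta x - BStheta y)%:~R))%:C *
          psi ((T p * star (T q)) * (T x * star (T y))) &
      beta = 0 -> forall t X, psi (alpha t X) = psi X].

End NicaCovariance.

(* Main.v *)
Require Import Defs.
From HB Require Import structures.
From mathcomp Require Import all_boot all_order all_algebra.
From mathcomp Require Import all_classical all_reals all_analysis.
From mathcomp Require Import complex.
From mathcomp Require Import ring.

Set Implicit Arguments.
Unset Strict Implicit.
Unset Printing Implicit Defensive.

Import Order.TTheory GRing.Theory Num.Theory.
Import numFieldNormedType.Exports.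

Local Open Scope ring_scope.

(** Let [p_x = T_x T_x^*] for [x] in [P].  The KMS condition applied to [T_x]
and [T_x^*] gives [psi p_x = exp (- beta * theta x)], because [T_x] is an
isometry and [psi 1 = 1].  All three parts concern a defect
[q = 1 - \sum_j p_(x_j)], where the ranges of the [T_(x_j)] are mutually
orthogonal.  Such a [q] is a projection, and
[psi q = 1 - \sum_j exp (- beta * theta x_j)] is computed in [KMS_defect].  For
the single element [b] this is [0]; for the family of the [b^j a], [j < d], it is
[1 - d * exp (- beta)].  So (b) is the positivity of [psi q]; in (c),
[psi q = 0] exactly when [beta = ln d], and a functional that factors through
the quotient by [q] kills [q].

What remains is that [psi q = 0] makes [psi] factor through the quotient by the
ideal that [q] generates ([KMS_factors_defect]).  The elements [x] with
[psi (u x v) = 0] for all [u], [v] form a closed ideal contained in the kernel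
of [psi], so it is enough that [q] is one of them.  For [u] and [v] of the form
[T_x T_y^*] the KMS condition rewrites [psi (u q v)] as a multiple of
[psi (v u q)], which vanishes by the Cauchy-Schwarz inequality since
[psi (q^* q) = psi q = 0].  The general case follows by linearity and
continuity from the density of the span of the [T_x T_y^*].

The density rests on the product of two elements [T_x T_y^*] being zero or
again of this form ([monomialM]), with additive degrees [theta x - theta y].
This uses Nica covariance for two kinds of pairs: [a] and [b], whose least
upper bound is [a b^c = b^d a], and [a] and [b^j a] with [0 < j < d], which have
no common upper bound.  They give
[T_a^* T_b = T_b^c T_a^* T_(b^(d-1))^*] and [T_a^* T_b^j T_a = 0], which suffice
to move all adjoints to the right.

Both facts about [P] follow from one: [b^i a p = b^j a q] with [p], [q] in [P]
and [i], [j < d] forces [i = j] ([BSpos_stem_inj]).  This is read off from an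
action of the group on a set with a subset that [P] preserves and on which [a]
takes values whose position is divisible by [d]. *)

(** * An action of the Baumslag-Solitar group *)

Section GroupAction.
Variables c d : nat.
Hypotheses (c_gt0 : (0 < c)%N) (d_gt0 : (0 < d)%N).
Local Notation G := (BS c d).

(** A position on a line together with the index of that line.  The generator
[b] translates every line by one.  The lines are indexed by two copies of [nat];
those tagged [true] form the subset that [P] preserves. *)
Definition site : Type := (int * (bool * nat))%type.

Definition translate (k : int) (z : site) : site := (z.1 + k, z.2).

(** [a] acts as [spread \o fold_c].  The first map turns translation by [c] into
translation by [1], merging the [c] residues of a position into the line index;
[spread] turns translation by [1] into translation by [d].  Hence
[a b^c = b^d a]. *)
Definition fold_c (z : site) : site :=
  ((z.1 %/ c)%Z, (z.2.1, (z.2.2 * c + `|(z.1 %% c)%Z|)%N)).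
Definition unfold_c (z : site) : site :=
  (z.1 * c%:Z + (z.2.2 %% c)%N%:Z, (z.2.1, (z.2.2 %/ c)%N)).

(** The sites reached from the lines tagged [true] must have positions divisible
by [d].  This leaves free, modulo translation by [d], the [d] residues on the
lines tagged [false] and the [d.-1] nonzero residues on the lines tagged [true].
The lines tagged [false] are dealt out to these [d + d.-1] kinds according to
their index modulo [d + d.-1]. *)
Definition spread (z : site) : site :=
  let: (k, (s, n)) := z in
  if s then (k * d%:Z, (true, n)) else
  let r := (n %% (d + d.-1))%N in let q := (n %/ (d + d.-1))%N in
  if (r < d)%N then (k * d%:Z + r%:Z, (false, q))
  else (k * d%:Z + (r - d).+1%:Z, (true, q)).
Definition unspread (z : site) : site :=
  let: (m, (s, q)) := z in
  let k := (m %/ d)%Z in let r := `|(m %% d)%Z|%N in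
  if s then
    if r is r'.+1 then (k, (false, q * (d + d.-1) + (r' + d))%N)
    else (k, (true, q))
  else (k, (false, q * (d + d.-1) + r)%N).

Lemma divmodzMDl (n : nat) (k : int) (r : nat) : (r < n)%N ->
  ((k * n%:Z + r%:Z) %/ n)%Z = k /\ `|((k * n%:Z + r%:Z) %% n)%Z|%N = r.
Proof.
move=> rn; have n0 : n%:Z != 0 by rewrite eqz_nat -lt0n (leq_ltn_trans _ rn).
split; first by rewrite divzMDl // divz_small ?addr0 // ltz_nat rn.
by rewrite modzMDl modz_small ?ltz_nat.
Qed.

Lemma divmodnMDl (n k r : nat) : (r < n)%N ->
  ((k * n + r) %/ n)%N = k /\ ((k * n + r) %% n)%N = r.
Proof.
move=> rn; have n0 : (0 < n)%N by exact: leq_ltn_trans rn.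
by rewrite divnMDl // divn_small // addn0 modnMDl modn_small.
Qed.

Lemma modz_lt (n : nat) (m : int) : (0 < n)%N -> (`|(m %% n)%Z| < n)%N.
Proof.
move=> n0; rewrite -ltz_nat gez0_abs ?modz_ge0 ?ltz_pmod // ?ltz_nat //.
by rewrite eqz_nat -lt0n.
Qed.

Lemma divz_eq_abs (n : nat) (m : int) : (0 < n)%N ->
  (m %/ n)%Z * n%:Z + `|(m %% n)%Z|%N%:Z = m.
Proof.
move=> n0; rewrite gez0_abs ?modz_ge0 -?divz_eq //.
by rewrite eqz_nat -lt0n.
Qed.

Lemma fold_cK : cancel fold_c unfold_c.
Proof.
move=> [m [s n]]; rewrite /unfold_c /fold_c /=.
have [-> ->] := divmodnMDl n (modz_lt m c_gt0).
by rewrite divz_eq_abs.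
Qed.

Lemma unfold_cK : cancel unfold_c fold_c.
Proof.
move=> [m [s n]]; rewrite /unfold_c /fold_c /=.
have [-> ->] := divmodzMDl m (ltn_pmod n c_gt0).
by rewrite -divn_eq.
Qed.

Lemma kinds_gt0 : (0 < d + d.-1)%N. Proof. by rewrite addn_gt0 d_gt0. Qed.

Lemma spreadK : cancel spread unspread.
Proof.
move=> [k [[] n]] /=.
  by have [] := divmodzMDl k d_gt0; rewrite addr0 => -> ->.
have [rd|dr] := ltnP.
  by rewrite /unspread; have [-> ->] := divmodzMDl k rd; rewrite -divn_eq.
have rd : ((n %% (d + d.-1) - d).+1 < d)%N.
  rewrite -subSn // ltn_subLR ?leqW // -[X in (_ < _ + X)%N](prednK d_gt0).
  by rewrite addnS ltnS ltn_pmod ?kinds_gt0.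
by rewrite /unspread; have [-> ->] := divmodzMDl k rd; rewrite subnK // -divn_eq.
Qed.

Lemma unspreadK : cancel unspread spread.
Proof.
move=> [m [s q]]; rewrite /unspread.
have rd := modz_lt m d_gt0; have e := divz_eq_abs m d_gt0.
case: s; last first.
  rewrite /spread; have rd2 := ltn_addr d.-1 rd.
  by have [-> ->] := divmodnMDl q rd2; rewrite rd e.
case: `|_|%N rd e => [|r] rd e; rewrite /spread; first by rewrite -[in RHS]e addr0.
have rd2 : (r + d < d + d.-1)%N by rewrite addnC ltn_add2l -ltnS (prednK d_gt0).
have [-> ->] := divmodnMDl q rd2.
by rewrite ltnNge leq_addl /= addnK e.
Qed.

Definition letter_act (l : letter) : site -> site :=
  match l with
  | (true, false) => spread \o fold_c
  | (true, true) => unfold_c \o unspread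
  | (false, false) => translate 1
  | (false, true) => translate (-1)
  end.

Definition word_act (u : seq letter) (z : site) : site := foldr letter_act z u.

Lemma word_act_b n z : word_act (nseq n letter_b) z = translate n%:Z z.
Proof.
elim: n => [|n ih] /=; first by rewrite /translate addr0; case: z.
by rewrite ih /translate /= intS -addrA [_ + 1]addrC.
Qed.

Lemma fold_c_translate z : fold_c (translate c%:Z z) = translate 1 (fold_c z).
Proof.
have c0 : c%:Z != 0 by rewrite eqz_nat -lt0n.
by rewrite /fold_c /translate /= -[X in _ + X]mul1r addrC divzMDl // modzMDl addrC.
Qed.

Lemma spread_translate z : spread (translate 1 z) = translate d%:Z (spread z).
Proof.
case: z => k [[] t]; rewrite /translate /=; first by rewrite mulrDl mul1r.
by case: ifP => _ /=; rewrite mulrDl mul1r addrAC.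
Qed.

(** The defining relation holds because [a] conjugates translation by [c] to
translation by [d]. *)
Lemma word_act_cong u v : BS_cong c d u v -> word_act u =1 word_act v.
Proof.
elim=> //.
- by move=> {}u {}v _ h z; rewrite h.
- by move=> {}u {}v w _ h1 _ h2 z; rewrite h1.
- move=> {}u u' {}v v' _ h1 _ h2 z; rewrite /word_act !foldr_cat.
  by rewrite -!/(word_act _ _) h2 h1.
- move=> [[] []] z.
  + exact: etrans (congr1 unfold_c (spreadK _)) (fold_cK z).
  + exact: etrans (congr1 spread (unfold_cK _)) (unspreadK z).
  + by case: z => m z; congr (_, _); exact: addrK.
  + by case: z => m z; congr (_, _); exact: subrK.
- move=> z; rewrite -cats1 /word_act foldr_cat.
  change (spread (fold_c (word_act (nseq c letter_b) z)) =
    word_act (nseq d letter_b) (spread (fold_c z))).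
  by rewrite !word_act_b fold_c_translate spread_translate.
Qed.

Definition BSact (g : G) : site -> site := word_act (repr g).

Lemma BSact_word u : BSact (BS_word c d u) =1 word_act u.
Proof. exact/word_act_cong/BS_cong_repr. Qed.

Lemma BSactM (x y : G) z : BSact (x * y)%g z = BSact x (BSact y z).
Proof. by rewrite [LHS]BSact_word /word_act foldr_cat. Qed.

Lemma BSact_bX n z : BSact (BSb ^+ n)%g z = translate n%:Z z.
Proof.
elim: n z => [|n ih] z.
  by rewrite expg0 [LHS]BSact_word /translate addr0; case: z.
rewrite expgS BSactM ih [LHS]BSact_word; congr (_, _).
by rewrite /= [in RHS]intS -addrA [_ + 1]addrC.
Qed.

Lemma BSact_a m n :
  BSact BSa (m, (true, n)) = ((m %/ c)%Z * d%:Z, (true, n * c + `|(m %% c)%Z|)%N).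
Proof. by rewrite BSact_word. Qed.

Lemma BSpos_act (x : G) (z : site) : BSpos x -> z.2.1 -> (BSact x z).2.1.
Proof.
move=> hx; elim: hx z => {x} [|||x y _ ihx _ ihy] z.
- by rewrite BSact_word.
- by case: z => m [[] n] //; rewrite BSact_a.
- by rewrite BSact_word.
- by rewrite BSactM => h; apply/ihx/ihy.
Qed.

(** * Least upper bounds in the positive cone *)

Lemma BSpos_bX n : BSpos (BSb ^+ n : G)%g.
Proof.
elim: n => [|n ih]; first exact: BSpos1.
by rewrite expgS; apply: BSposM => //; exact: BSpos_b.
Qed.

Lemma BSpos_bXa n : BSpos (BSb ^+ n * BSa : G)%g.
Proof. by apply: BSposM; [exact: BSpos_bX | exact: BSpos_a]. Qed.

(** Acting on a site tagged [true], an element [b^k a r] with [r] in [P] leads to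
a position congruent to [k] modulo [d], so [k] can be recovered from it. *)
Lemma BSpos_stem_inj i j (p q : G) : BSpos p -> BSpos q -> (i < d)%N -> (j < d)%N ->
  (BSb ^+ i * BSa * p = BSb ^+ j * BSa * q)%g -> i = j.
Proof.
have stem k (r : G) : BSpos r -> (k < d)%N ->
    `|((BSact (BSb ^+ k * BSa * r)%g (0, (true, 0%N))).1 %% d)%Z|%N = k.
  move=> hr kd; have := BSpos_act (z := (0, (true, 0%N))) hr isT.
  rewrite !BSactM; case: (BSact r _) => m [[] n] // _.
  by rewrite BSact_a BSact_bX /=; have [] := divmodzMDl (m %/ c)%Z kd.
by move=> hp hq hi hj e; rewrite -(stem i p hp hi) e stem.
Qed.

Lemma BStheta_bX n : BStheta (BSb ^+ n : G)%g = 0.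
Proof.
elim: n => [|n ih]; first by rewrite expg0 BStheta_word /word_height big_nil.
by rewrite expgS BSthetaM BStheta_b ih.
Qed.

Lemma BStheta_bXa n : BStheta (BSb ^+ n * BSa : G)%g = 1.
Proof. by rewrite BSthetaM BStheta_bX BStheta_a. Qed.

Lemma BStheta_ge0 (x : G) : BSpos x -> 0 <= BStheta x.
Proof.
elim=> {x} [|||x y _ ihx _ ihy].
- by have := BStheta_bX 0; rewrite expg0 => ->.
- by rewrite BStheta_a.
- by rewrite BStheta_b.
- by rewrite BSthetaM addr_ge0.
Qed.

(** The first occurrence of [a] in a positive word.  Keeping the form of the tail
provides induction on the number of occurrences of [a]. *)
Inductive stem_form : set G :=
| stem_b n : stem_form (BSb ^+ n)%g
| stem_a n q : BSpos q -> stem_form q -> stem_form (BSb ^+ n * BSa * q)%g.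

Lemma BSpos_stem (x : G) : BSpos x -> stem_form x.
Proof.
have stemb n (q : G) : stem_form q -> stem_form (BSb ^+ n * q)%g.
  by case=> [m|m r hr fr]; rewrite ?mulgA -expgnDr; constructor.
suff h : BSpos x -> forall y, BSpos y -> stem_form y -> stem_form (x * y)%g.
  by move=> hx; have := h hx _ (BSpos1 c d) (stem_b 0); rewrite mulg1.
elim=> {x} [|||x y hx ihx hy ihy] q hq fq.
- by rewrite mul1g.
- by have := stem_a 0 hq fq; rewrite mul1g.
- exact: (stemb 1%N).
- by rewrite -mulgA; apply: ihx; [exact: BSposM | exact: ihy].
Qed.

Lemma BS_relationX k : (BSb ^+ (k * d) * BSa = BSa * BSb ^+ (k * c) :> G)%g.
Proof.
elim: k => [|k ih]; first by rewrite !mul0n mul1g mulg1.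
by rewrite !mulSn !expgnDr -mulgA ih !mulgA -BS_relation.
Qed.

(** If [w = a p = b q] is positive, then [q] contains an [a], since [theta p >= 0].
Writing [b q = b^(j + k d) a r = b^j a b^(k c) r] with [j < d] and comparing with
[a p], one gets [j = 0] and [p = b^(k c) r] with [k > 0], so [p] starts with
[b^c]. *)
Lemma BSlub_ab : BSlub (BSa : G) BSb (BSa * BSb ^+ c)%g.
Proof.
split; first split.
- by apply: BSposM; [exact: BSpos_a | exact: BSpos_bX].
- by rewrite /BSle mulKg; exact: BSpos_bX.
- have bd : (BSb ^+ d = BSb * BSb ^+ d.-1 :> G)%g by rewrite -expgS prednK.
  rewrite /BSle BS_relation bd -mulgA mulKg.
  exact: BSpos_bXa.
move=> w [_]; rewrite /BSle invgM -mulgA.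
set p := (_^-1 * w)%g => hp hq.
have ew : w = (BSa * p)%g by rewrite mulVKg.
have := mulVKg BSb w; case: (BSpos_stem hq) => [n|n r hr _].
  move=> e; have := congr1 (@BStheta c d) e.
  rewrite -expgS BStheta_bX ew BSthetaM BStheta_a => {}e.
  by have := BStheta_ge0 hp; rewrite -(lerD2l 1) -e.
rewrite !mulgA -expgS (divn_eq n.+1 d) addnC expgnDr.
rewrite -(mulgA (BSb ^+ (_ %% _))%g) BS_relationX.
rewrite ew -!mulgA => e.
have hpos k : BSpos (BSb ^+ k * r)%g by apply: BSposM => //; exact: BSpos_bX.
have r0 : (n.+1 %% d = 0)%N.
  apply: (BSpos_stem_inj (hpos _) hp) => //; first exact: ltn_pmod.
  by rewrite -!mulgA mul1g; exact: e.
move: e; rewrite r0 expg0 mul1g => /mulgI <-.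
have k0 : (0 < n.+1 %/ d)%N by rewrite divn_gt0 // dvdn_leq // /dvdn r0.
rewrite mulKg -(prednK k0) mulSn expgnDr -mulgA mulKg; exact: hpos.
Qed.

Lemma BSub_a_bXa j : (0 < j < d)%N -> ~ exists z : G, BSub BSa (BSb ^+ j * BSa)%g z.
Proof.
case/andP=> j0 jd [z [_]]; rewrite /BSle => ha hb.
have /esym j00 : 0%N = j; last by rewrite j00 in j0.
by apply: (BSpos_stem_inj ha hb) => //; rewrite mul1g !mulVKg.
Qed.

End GroupAction.

(** * Elementary facts on C*-algebras *)

Section Star.
Local Open Scope complex_scope.
Variables (R : realType) (A : cstarAlgType R).
Implicit Types (x y : A).

Lemma star0 : star (0 : A) = 0.
Proof. by have := starZ 0 (0 : A); rewrite rmorph0 !scale0r. Qed.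

Lemma starN x : star (- x) = - star x.
Proof. by rewrite -scaleN1r starZ rmorphN rmorph1 scaleN1r. Qed.

Lemma star1 : star (1 : A) = 1.
Proof. by have := starM 1 (star (1 : A)); rewrite mul1r !starK mul1r. Qed.

Lemma starX x n : star (x ^+ n) = star x ^+ n.
Proof.
by elim: n => [|n ih]; rewrite ?expr0 ?star1 // exprS starM ih -exprSr.
Qed.

Lemma star_sum (I : Type) (r : seq I) (F : I -> A) :
  star (\sum_(i <- r) F i) = \sum_(i <- r) star (F i).
Proof. exact: (big_morph _ (@starD R A) star0). Qed.

Lemma cnorm_star x : cnorm (star x) = cnorm x.
Proof.
suff h y : cnorm y <= cnorm (star y).
  by apply/eqP; rewrite eq_le h andbT -[leRHS](congr1 cnorm (starK x)) h.
have [->|y0] := eqVneq (cnorm y) 0; first exact: cnorm_ge0.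
rewrite -(@ler_pM2r _ (cnorm y)) ?lt0r ?y0 ?cnorm_ge0 //.
by rewrite -expr2 -cstar_norm cnormM.
Qed.

Lemma cnorm1_le1 : cnorm (1 : A) <= 1.
Proof.
have := cstar_norm (1 : A); rewrite star1 mulr1 expr2 => h.
have [->|n0] := eqVneq (cnorm (1 : A)) 0; first exact: ler01.
by rewrite (_ : cnorm 1 = 1) //; apply: (mulfI n0); rewrite -h mulr1.
Qed.

(** A bounded additive functional is continuous. *)
Lemma ker_closed (f : A -> R[i]) (M : R) :
  (forall x y, f (x - y) = f x - f y) -> (forall x, `|f x| <= (M * cnorm x)%:C) ->
  cstar_closed [set x | f x = 0].
Proof.
move=> fB fM x hx; apply/eqP; rewrite -normr_eq0; apply/negP => /negP f0.
have fx0 : 0 < `|f x| by rewrite lt0r f0 normr_ge0.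
have [e e0 he] : exists2 e : R, 0 < e & `|f x| = e%:C.
  exists (complex.Re `|f x|); last by rewrite RRe_real ?normr_real.
  by rewrite -(ltcR 0 (complex.Re `|f x|)) RRe_real ?normr_real.
pose N := `|M| + 1; have N0 : 0 < N by rewrite ltr_wpDl.
have [y fy xy] := hx (e / N) (divr_gt0 e0 N0).
have := fM (x - y); rewrite fB fy subr0 he lecR leNgt => /negP; apply.
rewrite ltr_pdivlMr // mulrC in xy; apply: le_lt_trans xy.
by apply: ler_wpM2r; rewrite ?cnorm_ge0 // (le_trans (ler_norm _)) // lerDl.
Qed.

Lemma proj_sum n (p : 'I_n -> A) :
  (forall i, star (p i) = p i) -> (forall i, p i * p i = p i) ->
  (forall i j, i != j -> p i * p j = 0) ->
  star (1 - \sum_i p i) * (1 - \sum_i p i) = 1 - \sum_i p i.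
Proof.
move=> ps pp pq; rewrite starD starN star1 star_sum (eq_bigr p) //.
have e : (\sum_i p i) * (\sum_i p i) = \sum_i p i.
  rewrite mulr_suml; apply: eq_bigr => i _; rewrite mulr_sumr (bigD1 i) //= pp.
  by rewrite big1 ?addr0 // => j ji; rewrite pq // eq_sym.
by rewrite mulrBr mulr1 mulrBl mul1r e subrr subr0.
Qed.
End Star.

Section PositiveForms.
Variable C : numClosedFieldType.
Implicit Types u v p r s : C.

(** For a positive functional [f], with [u = f (x^* y)] and [v = f (y^* x)], the
assumption follows from [f] being real on [(x + k y)^* (x + k y)]; the cases
[k = 1] and [k = 'i] determine [v]. *)
Lemma conj_of_real_comb u v :
  (forall k : C, k * u + Num.conj k * v \is Num.real) -> v = Num.conj u.
Proof.
move=> h; have := h 'i; have := h 1.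
rewrite rmorph1 conjCi !mul1r mulNr -mulrBr => /CrealP h2 /CrealP.
rewrite rmorphM /= conjCi rmorphB /= => h1; rewrite rmorphD /= in h2.
have {}h1 : Num.conj u - Num.conj v = v - u.
  by apply: (mulfI (neq0Ci C)); rewrite -[LHS]opprK -mulNr h1 -mulrN opprB.
apply: (mulfI (_ : 2%:R != 0)); first by rewrite pnatr_eq0.
rewrite !mulr_natl !mulr2n.
have -> : v + v = (u + v) + (v - u) by ring.
by rewrite -h1 -h2; ring.
Qed.

(** For [p > 0] take [t = 1 / p], the minimum of the quadratic; for [p = 0] the
linear function of [t] stays nonnegative only if [s = 0]. *)
Lemma discriminant_le p r s : 0 <= p -> 0 <= r ->
  (forall t : C, t \is Num.real ->
    0 <= t ^+ 2 * `|s| ^+ 2 * p - t * `|s| ^+ 2 *+ 2 + r) ->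
  `|s| ^+ 2 <= p * r.
Proof.
move=> p0 r0 key.
have [p1|p1] := eqVneq p 0; last first.
  have pv : p^-1 \is Num.real by rewrite realV ger0_real.
  have := key _ pv; rewrite -(@pmulr_rge0 _ p) ?lt0r ?p1 //.
  have -> : p * (p^-1 ^+ 2 * `|s| ^+ 2 * p - p^-1 * `|s| ^+ 2 *+ 2 + r) =
      p * r - `|s| ^+ 2.
    by field.
  by rewrite subr_ge0.
rewrite p1 mul0r; case: (eqVneq s 0) => [->|s0]; first by rewrite normr0 expr0n.
have n0 : 0 < `|s| ^+ 2 by rewrite exprn_gt0 // normr_gt0.
(* at this t the quadratic takes the value - (r + 2) < 0 *)
have tr : (r + 1) / `|s| ^+ 2 \is Num.real.
  by rewrite rpredM ?realV ?(ger0_real (ltW n0)) // rpredD ?rpred1 ?ger0_real.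
have := key _ tr; rewrite p1 mulr0 sub0r divfK ?gt_eqF //.
have -> : - ((r + 1) *+ 2) + r = - (r + 2%:R) by ring.
by rewrite oppr_ge0 => /(lt_le_trans (ltr_wpDl r0 (ltr0Sn C 1))); rewrite ltxx.
Qed.
End PositiveForms.

(** * States *)

Section State.
Variables (R : realType) (A : cstarAlgType R) (psi : {scalar A}).
Hypothesis hpsi : is_state psi.
Implicit Types (x y : A).
Let C : numClosedFieldType := R[i].

Let psi_ge0 x : 0 <= psi (star x * x) :> C. Proof. by have [h _ _] := hpsi. Qed.
Let psiD x y : psi (x + y) = psi x + psi y :> C. Proof. exact: linearD. Qed.
Let psiZ (k : C) x : psi (k *: x) = k * psi x :> C. Proof. exact: linearZ. Qed.

Let psi_quadratic (k : C) x y : psi (star (x + k *: y) * (x + k *: y)) =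
    psi (star x * x) + Num.conj k * k * psi (star y * y) +
    (k * psi (star x * y) + Num.conj k * psi (star y * x)) :> C.
Proof.
have -> : star (x + k *: y) * (x + k *: y) = star x * x + k *: (star x * y) +
    (Num.conj k *: (star y * x) + Num.conj k *: (k *: (star y * y))).
  by rewrite starD starZ mulrDl !mulrDr -!scalerAl -!scalerAr.
by rewrite !psiD !psiZ; ring.
Qed.

Lemma state_conj x y : psi (star y * x) = Num.conj (psi (star x * y) : C).
Proof.
apply: conj_of_real_comb => k.
have /ger0_real := psi_ge0 (x + k *: y); rewrite psi_quadratic rpredDl //.
rewrite (mulrC (Num.conj k)) -normCK.
by rewrite rpredD ?rpredM ?rpredX ?normr_real // ?ger0_real.
Qed.

Lemma state_CS x y :
  `|psi (star x * y) : C| ^+ 2 <= psi (star x * x) * psi (star y * y).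
Proof.
apply: discriminant_le; rewrite ?psi_ge0 // => t /CrealP tr.
have := psi_ge0 (y + (- (t * psi (star x * y))) *: x).
rewrite psi_quadratic (state_conj x y) rmorphN rmorphM /= tr normCK.
by congr (_ <= _); ring.
Qed.

Local Open Scope complex_scope.

(** By Cauchy-Schwarz with one argument [1], [sqrt (psi 1)] is a bound for [psi],
so it is at least the norm [1]. *)
Lemma state1 : psi 1 = 1.
Proof.
have [_ hle hmin] := hpsi.
have p1 : 0 <= psi 1 by rewrite -[1](mul1r 1) -{1}star1.
have [u u0 hu] : exists2 u : R, 0 <= u & psi 1 = u%:C.
  exists (complex.Re (psi 1)); last by rewrite RRe_real ?ger0_real.
  by rewrite -(lecR 0) RRe_real ?ger0_real.
have u1 : u <= 1.
  have := hle 1; rewrite ger0_norm // hu lecR => /le_trans; apply.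
  exact: cnorm1_le1.
suff : 1 <= Num.sqrt u.
  move=> h; rewrite hu; congr _%:C; apply/eqP; rewrite eq_le u1 /=.
  by rewrite -(sqr_sqrtr u0) exprn_ege1.
apply: hmin => x.
have := state_CS 1 x; rewrite star1 !mul1r hu => h.
rewrite -(@ler_pXn2r _ 2) ?nnegrE ?normr_ge0 ?lecR ?mulr_ge0 ?sqrtr_ge0 ?cnorm_ge0 //.
apply: (le_trans h); rewrite -rmorphXn /= exprMn sqr_sqrtr // -cstar_norm rmorphM /=.
apply: ler_wpM2l; first by rewrite lecR.
by rewrite -[leLHS]ger0_norm.
Qed.

Lemma state_ideal0 q w : psi (star q * q) = 0 -> psi (w * q) = 0.
Proof.
move=> q0; have := state_CS (star w) q; rewrite starK q0 mulr0.
by rewrite real_exprn_even_le0 ?normr_real //= normr_eq0 => /eqP.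
Qed.

Lemma state_sandwich_le u v x :
  `|psi (u * x * v)| <= (cnorm u * cnorm v * cnorm x)%:C.
Proof.
have [_ hle _] := hpsi; apply: le_trans (hle _) _; rewrite lecR.
apply: le_trans (cnormM _ _) _; rewrite mulrAC.
by apply: ler_wpM2r; rewrite ?cnorm_ge0 ?cnormM.
Qed.

Fact sandwich_closed : cstar_closed [set x | forall u v, psi (u * x * v) = 0].
Proof.
move=> x hx u v.
apply: (ker_closed (f := fun x => psi (u * x * v)) (M := cnorm u * cnorm v)).
- by move=> y z; rewrite mulrBr mulrBl linearB.
- exact: state_sandwich_le.
- by move=> e /hx[y hy xy]; exists y => //; exact: hy.
Qed.

(** The largest ideal contained in the kernel of [psi]. *)
Definition sandwich_ideal : closed_ideal A.
Proof.
refine (@ClosedIdeal _ _ [set x | forall u v, psi (u * x * v) = 0]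
  _ _ _ _ sandwich_closed).
- by move=> u v; rewrite mulr0 mul0r linear0.
- by move=> x y hx hy u v; rewrite mulrDr mulrDl linearD hx hy addr0.
- by move=> x y hy u v; rewrite mulrA hy.
- by move=> x y hx u v; rewrite mulrA -mulrA hx.
Defined.

(** The hypothesis puts [q], hence the ideal that it generates, into
[sandwich_ideal]; evaluating [psi] on representatives is then linear. *)
Lemma factors_through_ideal_gen q :
  (forall u v, psi (u * q * v) = 0) -> factors_through (ideal_gen q) psi.
Proof.
move=> hq; pose I := ideal_gen q.
have ker x : ideal_set I x -> psi x = 0.
  by move=> /(_ sandwich_ideal hq 1 1); rewrite mul1r mulr1.
pose f (u : ideal_quotient I) : R[i] := psi (repr (u : Quotient.quot (ideal_pred I))).
have fE x : psi x = f (ideal_pi I x).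
  apply/eqP; rewrite -subr_eq0 -linearB; apply/eqP/ker/ideal_piP.
  by rewrite ideal_pi_repr.
have flin : linear_for *%R f.
  move=> k u v; rewrite -(ideal_pi_repr u) -(ideal_pi_repr v).
  rewrite -[k *: _]ideal_piZ -ideal_piD -!fE.
  by rewrite linearP.
pose F := GRing.isLinear.Build _ _ _ _ f flin.
by exists (HB.pack f F : {scalar (ideal_quotient I)}).
Qed.

End State.

Lemma factors_through_gen0 (R : realType) (A : cstarAlgType R) (psi : {scalar A}) q :
  factors_through (ideal_gen q) psi -> psi q = 0.
Proof.
case=> phi ->; rewrite (_ : ideal_pi _ q = ideal_pi _ 0).
  have := ideal_piD (ideal_gen q) 0 0; rewrite addr0 => /eqP.
  by rewrite -subr_eq subrr => /eqP <-; rewrite linear0.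
by apply/ideal_piP; rewrite subr0 => I.
Qed.

(** * Nica covariant representations *)

Section NicaCovariant.
Variables (R : realType) (c d : nat).
Hypotheses (c_gt0 : (0 < c)%N) (d_gt0 : (0 < d)%N).
Variables (A : cstarAlgType R) (T : BS c d -> A).
Hypothesis hT : nica_covariant T.
Local Notation G := (BS c d).
Local Notation a := (T BSa).
Local Notation b := (T BSb).

Lemma nica_isometry x : BSpos x -> star (T x) * T x = 1.
Proof. by have [h _ _ _ _] := hT; exact: h. Qed.

Lemma nica1 : T 1%g = 1.
Proof. by have [_ h _ _ _] := hT. Qed.

Lemma nicaM x y : BSpos x -> BSpos y -> T (x * y)%g = T x * T y.
Proof. by have [_ _ h _ _] := hT; exact: h. Qed.

Lemma nica_bX n : T (BSb ^+ n)%g = b ^+ n.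
Proof.
elim: n => [|n ih]; first by rewrite nica1.
rewrite expgS exprS nicaM ?ih //; [exact: BSpos_b | exact: BSpos_bX].
Qed.

Lemma nica_bXa n : T (BSb ^+ n * BSa)%g = b ^+ n * a.
Proof. by rewrite nicaM ?nica_bX //; [exact: BSpos_bX | exact: BSpos_a]. Qed.

Lemma star_bX_bX m n :
  star b ^+ m * b ^+ n = if (m <= n)%N then b ^+ (n - m) else star b ^+ (m - n).
Proof.
have iso k : star b ^+ k * b ^+ k = 1.
  by rewrite -starX -nica_bX nica_isometry //; exact: BSpos_bX.
case: leqP => h.
  by rewrite -{1}(subnKC h) exprD mulrA iso mul1r.
by rewrite -{1}(subnK (ltnW h)) exprD -mulrA iso mulr1.
Qed.

Lemma star_a_a : star a * a = 1.
Proof. exact/nica_isometry/BSpos_a. Qed.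

(** Nica covariance for [a] and [b] reads
[a a^* b b^* = (a b^c) (b^d a)^*]; multiply by [a^*] and [b]. *)
Lemma star_a_b : star a * b = b ^+ c * star a * star b ^+ d.-1.
Proof.
have [_ _ _ + _] := hT.
move=> /(_ _ _ _ (BSpos_a c d) (BSpos_b c d) (BSlub_ab c_gt0 d_gt0)) e.
have e2 : star a * (a * star a * (b * star b)) * b = star a * b.
  by rewrite !mulrA star_a_a mul1r -!mulrA (nica_isometry (BSpos_b c d)) mulr1.
rewrite -e2 e {2}BS_relation nica_bXa nicaM ?nica_bX;
  [|exact: BSpos_a|exact: BSpos_bX].
rewrite starM starX !mulrA star_a_a mul1r -!mulrA; congr (_ * (_ * _)).
have red n : (0 < n)%N -> star b ^+ n * b = star b ^+ n.-1.
  by case: n => // n _; rewrite exprSr -mulrA (nica_isometry (BSpos_b c d)) mulr1.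
exact: red.
Qed.

Lemma star_a_bXa j : (0 < j < d)%N -> star a * b ^+ j * a = 0.
Proof.
move=> hj; have [_ _ _ _] := hT.
move=> /(_ _ _ (BSpos_a c d) (BSpos_bXa _ _ j) (BSub_a_bXa c_gt0 d_gt0 hj)) e.
have := congr1 (fun z => star a * z * T (BSb ^+ j * BSa)%g) e.
rewrite /= mulr0 mul0r !mulrA star_a_a mul1r -!mulrA nica_isometry ?mulr1;
  last exact: BSpos_bXa.
by rewrite nica_bXa.
Qed.

Lemma star_b_a : star b * a = b ^+ d.-1 * a * star b ^+ c.
Proof.
by have := congr1 (@star R A) star_a_b; rewrite !starM !starX !starK mulrA.
Qed.

Lemma star_a_bXd k : star a * b ^+ (k * d) = b ^+ (k * c) * star a.
Proof.
elim: k => [|k ih]; first by rewrite !mul0n !expr0 mulr1 mul1r.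
have bd : b ^+ d = b * b ^+ d.-1 by rewrite -exprS prednK.
rewrite !mulSn !exprD mulrA bd mulrA star_a_b.
rewrite -[_ * b ^+ d.-1]mulrA star_bX_bX leqnn subnn expr0 mulr1.
by rewrite -mulrA ih mulrA.
Qed.

(** Each [b^*] either cancels against a [b] or passes [a] by [star_b_a]. *)
Lemma star_bX_a m : exists i k, star b ^+ m * a = b ^+ i * a * star b ^+ k.
Proof.
elim: m => [|m [i [k ih]]]; first by exists 0%N, 0%N; rewrite !expr0 mulr1.
rewrite exprS -mulrA ih; case: i {ih} => [|i]; last first.
  exists i, k; rewrite exprS !mulrA.
  by rewrite (nica_isometry (BSpos_b c d)) mul1r.
exists d.-1, (c + k)%N.
by rewrite expr0 mul1r mulrA star_b_a exprD mulrA.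
Qed.

(** Divide [n] by [d]: the quotient passes [a^*] by [star_a_bXd], and
[star_a_bXa] kills the product if the remainder is not zero. *)
Lemma star_a_bX_a n :
  star a * b ^+ n * a = 0 \/ exists k, star a * b ^+ n * a = b ^+ k.
Proof.
rewrite (divn_eq n d) exprD [star a * _]mulrA star_a_bXd -!mulrA.
have [->|r0] := posnP (n %% d).
  by right; exists (n %/ d * c)%N; rewrite expr0 mul1r star_a_a mulr1.
by left; rewrite [star a * _]mulrA star_a_bXa ?mulr0 // r0 ltn_pmod.
Qed.

(** Zero is included in every degree, so that products of monomials are
monomials. *)
Definition monomial (k : int) (X : A) : Prop := X = 0 \/
  exists x y : G, [/\ BSpos x, BSpos y, X = T x * star (T y) &
                     k = BStheta x - BStheta y].

Lemma monomial_TT x y : BSpos x -> BSpos y ->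
  monomial (BStheta x - BStheta y) (T x * star (T y)).
Proof. by move=> hx hy; right; exists x, y. Qed.

Lemma BStheta1 : BStheta (1%g : G) = 0.
Proof. by have := BStheta_bX c d 0; rewrite expg0. Qed.

Lemma monomial1 : monomial 0 1.
Proof.
have := monomial_TT (BSpos1 c d) (BSpos1 c d).
by rewrite subrr nica1 star1 mulr1.
Qed.

Lemma monomial_mulT x k X :
  BSpos x -> monomial k X -> monomial (BStheta x + k) (T x * X).
Proof.
move=> hx [->|[u [v [hu hv -> ->]]]]; first by left; rewrite mulr0.
rewrite mulrA -nicaM // addrA -BSthetaM; apply: monomial_TT => //.
exact: BSposM.
Qed.

Lemma monomial_bX n k X : monomial k X -> monomial k (b ^+ n * X).
Proof.
by move/(monomial_mulT (BSpos_bX c d n)); rewrite nica_bX BStheta_bX add0r.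
Qed.

Lemma monomial_starT y : BSpos y -> monomial (- BStheta y) (star (T y)).
Proof.
by move/(monomial_TT (BSpos1 c d)); rewrite BStheta1 sub0r nica1 mul1r.
Qed.

Lemma monomial_star_bX_starT n y :
  BSpos y -> monomial (- BStheta y) (star b ^+ n * star (T y)).
Proof.
move=> hy; rewrite -starX -nica_bX -starM -nicaM //; last exact: BSpos_bX.
have := monomial_starT (BSposM hy (BSpos_bX c d n)).
by rewrite BSthetaM BStheta_bX addr0.
Qed.

(** By [star_bX_a], passing the first [a] of [x] turns the power of [b^*] into
another one, whence the induction on the number of occurrences of [a] in [x]. *)
Lemma monomial_star_b m k X : monomial k X -> monomial k (star b ^+ m * X).
Proof.
case=> [->|[x [y [hx hy -> ->]]]]; first by left; rewrite mulr0.
elim: (BSpos_stem hx) m => {x hx} [n|n q hq _ ih] m.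
  rewrite BStheta_bX sub0r nica_bX mulrA star_bX_bX; case: leqP => _.
    exact/monomial_bX/monomial_starT.
  exact: monomial_star_bX_starT.
rewrite nicaM ?nica_bXa //; last exact: BSpos_bXa.
rewrite BSthetaM BStheta_bXa -addrA -!mulrA mulrA star_bX_bX.
have [ha mq] := (BSpos_a c d, ih 0%N); rewrite expr0 mul1r in mq.
have := monomial_mulT ha mq; rewrite BStheta_a => maq.
case: leqP => _; first exact: monomial_bX.
have [i [k' e]] := star_bX_a (m - n).
rewrite [_ * (a * _)]mulrA e -!mulrA; apply: monomial_bX.
by have := monomial_mulT ha (ih k'); rewrite BStheta_a.
Qed.

Lemma monomial_star_a k X : monomial k X -> monomial (k - 1) (star a * X).
Proof.
case=> [->|[x [y [hx hy -> ->]]]]; first by left; rewrite mulr0.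
case: (BSpos_stem hx) => {x hx} [n|n q hq _].
  have [i [k' e]] := star_bX_a n.
  have {}e : star a * b ^+ n = b ^+ k' * (star a * star b ^+ i).
    by have := congr1 (@star R A) e; rewrite !starM !starX !starK.
  rewrite BStheta_bX sub0r nica_bX mulrA e -!mulrA; apply: monomial_bX.
  have := monomial_starT (BSposM hy (BSpos_bXa c d i)).
  rewrite BSthetaM BStheta_bXa opprD nicaM ?nica_bXa //; last exact: BSpos_bXa.
  by rewrite !starM starX mulrA.
rewrite nicaM ?nica_bXa //; last exact: BSpos_bXa.
rewrite BSthetaM BStheta_bXa -[1 + _ - _]addrA [1 + _]addrC addrK !mulrA.
case: (star_a_bX_a n) => [->|[k' ->]]; first by left; rewrite !mul0r.
by rewrite -mulrA; apply: monomial_bX; exact: monomial_TT.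
Qed.

Lemma monomial_mul_starT x k X :
  BSpos x -> monomial k X -> monomial (k - BStheta x) (star (T x) * X).
Proof.
move=> hx; elim: hx k X => {x} [|||x y hx ihx hy ihy] k X mX.
- by rewrite nica1 star1 mul1r BStheta1 subr0.
- by rewrite BStheta_a; exact: monomial_star_a.
- by rewrite BStheta_b subr0 -[star b]expr1; exact: monomial_star_b.
- rewrite nicaM // starM -mulrA BSthetaM opprD addrA.
  by apply: ihy; exact: ihx.
Qed.

Lemma monomialM k l X Y : monomial k X -> monomial l Y -> monomial (k + l) (X * Y).
Proof.
case=> [->|[x [y [hx hy -> ->]]]] mY; first by left; rewrite mul0r.
rewrite -mulrA -addrA; apply: monomial_mulT => //; rewrite addrC.
exact: monomial_mul_starT.
Qed.

(** * Density of the span of the monomials *)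

Hypothesis hgen : forall D : set A, cstar_subalgebra D ->
  (forall x, BSpos x -> D (T x)) -> D = setT.

Definition closed_subspace (V : set A) : Prop :=
  (forall (k : R[i]) x y, V x -> V y -> V (k *: x + y)) /\ cstar_closed V.

(** Let [L] be the closed span of the monomials.  The [z] such that both [z] and
[z^*] map [L] into itself by left multiplication form a closed star-subalgebra
containing every [T_x], hence everything; apply this to [1] in [L]. *)
Lemma monomial_dense (V : set A) : closed_subspace V ->
  (forall k X, monomial k X -> V X) -> forall x, V x.
Proof.
move=> hV mV.
pose L x := forall W : set A, closed_subspace W ->
  (forall k X, monomial k X -> W X) -> W x.
have Llin k x y : L x -> L y -> L (k *: x + y).
  by move=> hx hy W hW mW; exact: (hW.1 _ _ _ (hx W hW mW) (hy W hW mW)).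
have Lcl : cstar_closed L.
  move=> x hx W hW mW; apply: hW.2 => e /hx[y hy xy].
  by exists y; [exact: (hy W hW mW) |].
pose M z := forall x, L x -> L (z * x).
have Mlin k y z : M y -> M z -> M (k *: y + z).
  move=> hy hz x hx; rewrite mulrDl -scalerAl.
  exact: (Llin _ _ _ (hy x hx) (hz x hx)).
have Mcl : cstar_closed M.
  move=> z hz x hx; apply: Lcl => e e0.
  have N0 : 0 < cnorm x + 1 by rewrite ltr_wpDl ?cnorm_ge0 ?ltr01.
  have [y hy zy] := hz (e / (cnorm x + 1)) (divr_gt0 e0 N0).
  exists (y * x); first exact: (hy x hx).
  rewrite -mulrBl; apply: le_lt_trans (cnormM _ _) _.
  rewrite ltr_pdivlMr // in zy; apply: le_lt_trans zy.
  by apply: ler_wpM2l; rewrite ?cnorm_ge0 // lerDl.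
have Mmono z : (forall k X, monomial k X -> exists l, monomial l (z * X)) -> M z.
  move=> mz x hx W [lW cW] mW; pose W' : set A := fun x => W (z * x).
  apply: (hx W'); last by move=> k X /mz[l]; exact: mW.
  split=> [k y y' hy hy'|y hy]; first by rewrite /W' mulrDr -scalerAr; exact: lW.
  apply: cW => e e0.
  have N0 : 0 < cnorm z + 1 by rewrite ltr_wpDl ?cnorm_ge0 ?ltr01.
  have [y' hy' yy'] := hy (e / (cnorm z + 1)) (divr_gt0 e0 N0).
  exists (z * y') => //; rewrite -mulrBr; apply: le_lt_trans (cnormM _ _) _.
  rewrite ltr_pdivlMr // in yy'; apply: le_lt_trans yy'.
  by rewrite mulrC; apply: ler_wpM2l; rewrite ?cnorm_ge0 // lerDl.
pose D : set A := fun z => M z /\ M (star z).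
have DT : D = setT.
  apply: hgen => [|x hx]; last first.
    split; apply: Mmono => k X mX; last first.
      by eexists; apply: (monomial_mul_starT hx mX).
    by eexists; apply: (monomial_mulT hx mX).
  split.
  - by rewrite /D star1; split=> x; rewrite mul1r.
  - move=> k x y [hx hx'] [hy hy']; rewrite /D starD starZ.
    by split; exact: Mlin.
  - move=> x y [hx hx'] [hy hy']; rewrite /D starM.
    split=> z hz; rewrite -mulrA; first exact: (hx _ (hy _ hz)).
    exact: (hy' _ (hx' _ hz)).
  - by move=> x [hx hx']; rewrite /D starK.
  - move=> x hx; split; apply: Mcl => e /hx[y [hy hy'] xy]; first by exists y.
    by exists (star y); rewrite // -starN -starD cnorm_star.
move=> x; have : D x by rewrite DT.
case=> /(_ 1); rewrite mulr1 => h _.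
by apply: (h _ V hV mV) => W _ mW; exact: (mW _ _ monomial1).
Qed.

End NicaCovariant.

(** * KMS states *)

Lemma nica_defect_proj (R : realType) (c d : nat) (A : cstarAlgType R)
    (T : BS c d -> A) n (x : 'I_n -> BS c d) : nica_covariant T ->
  (forall j, BSpos (x j)) ->
  (forall i j, i != j -> star (T (x i)) * T (x j) = 0) ->
  let q := 1 - \sum_j T (x j) * star (T (x j)) in star q * q = q.
Proof.
move=> hT x_pos x_orth; apply: proj_sum => [i|i|i j ij]; first by rewrite starM starK.
  by rewrite mulrA -[T _ * _ * _]mulrA nica_isometry // mulr1.
by rewrite mulrA -[T _ * _ * _]mulrA x_orth // mulr0 mul0r.
Qed.

Section KMS.
Variables (R : realType) (c d : nat).
Hypotheses (c_gt0 : (0 < c)%N) (d_gt0 : (0 < d)%N).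
Variables (A : cstarAlgType R) (T : BS c d -> A) (hT : is_CGP T).
Variables (alpha : R -> {lrmorphism A -> A}) (beta : R) (psi : {scalar A}).
Hypothesis hpsi : is_KMS T alpha beta psi.
Local Notation G := (BS c d).
Local Notation monomial := (monomial T).
Local Open Scope complex_scope.

Let nicaT : nica_covariant T := CGP_nica hT.
Let psi_state : is_state psi. Proof. by have [h _ _] := hpsi. Qed.
Let weight (k : int) : R[i] := (expR (- beta * k%:~R))%:C.

Lemma KMS_monomial k l X Y : monomial k X -> monomial l Y ->
  psi (X * Y) = weight k * psi (Y * X).
Proof.
case=> [->|[x [y [hx hy -> ->]]]]; first by rewrite mul0r mulr0 linear0 mulr0.
case=> [->|[p [q [hp hq -> _]]]]; first by rewrite mul0r mulr0 linear0 mulr0.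
by have [_ h _] := hpsi; exact: h.
Qed.

Lemma KMS_projection x : BSpos x ->
  psi (T x * star (T x)) = (expR (- beta * (BStheta x)%:~R))%:C.
Proof.
move=> hx.
have mx := monomial_mulT nicaT hx (monomial1 nicaT).
have := KMS_monomial mx (monomial_starT nicaT hx).
by rewrite mulr1 addr0 nica_isometry // (state1 psi_state) mulr1.
Qed.

Section Defect.
Variables (n : nat) (x : 'I_n -> G).
Hypothesis x_pos : forall j, BSpos (x j).
Hypothesis x_orth : forall i j, i != j -> star (T (x i)) * T (x j) = 0.

Let q : A := 1 - \sum_j T (x j) * star (T (x j)).

Lemma KMS_defect : psi q = 1 - \sum_j (expR (- beta * (BStheta (x j))%:~R))%:C.
Proof.
rewrite linearB linear_sum /= (state1 psi_state); congr (_ - _).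
by apply: eq_bigr => j _; exact: KMS_projection.
Qed.

(** The product [X * q] is a combination of monomials of the degree of [X]. *)
Lemma KMS_twist_defect k l X Y : monomial k X -> monomial l Y ->
  psi (X * q * Y) = weight k * psi (Y * (X * q)).
Proof.
move=> mX mY; rewrite /q mulrBr mulrBl mulrBr !linearB /= mulrBr mulr1.
rewrite (KMS_monomial mX mY); congr (_ - _).
rewrite mulr_sumr mulr_suml mulr_sumr !linear_sum mulr_sumr /=.
apply: eq_bigr => j _; apply: KMS_monomial (mY).
rewrite -[k]addr0 -(subrr (BStheta (x j))).
by apply: monomialM => //; exact: monomial_TT.
Qed.

(** On monomials [psi (u q v)] is a multiple of [psi (v u q)], and [psi (w q) = 0]
for all [w] by Cauchy-Schwarz. *)
Lemma KMS_factors_defect : psi q = 0 -> factors_through (ideal_gen q) psi.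
Proof.
move=> q0; have qq : psi (star q * q) = 0 by rewrite /q nica_defect_proj.
have hgen := CGP_generated hT.
have kerV (f : A -> R[i]) M : (forall (k : R[i]) u v, f (k *: u + v) = k * f u + f v) ->
    (forall u, `|f u| <= (M * cnorm u)%:C) -> closed_subspace [set u | f u = 0].
  move=> flin fM; split=> [k u v /= fu fv|]; first by rewrite flin fu fv mulr0 addr0.
  apply: ker_closed fM => u v.
  by rewrite -scaleN1r addrC flin mulN1r addrC.
have Vl v : closed_subspace [set u | psi (u * q * v) = 0].
  apply: (kerV (fun u => psi (u * q * v)) (cnorm (1 : A) * cnorm (q * v))) => [k y z|u].
    by rewrite !mulrDl -!scalerAl linearP.
  have := state_sandwich_le psi_state 1 (q * v) u.
  by rewrite mul1r mulrA.
have Vr X : closed_subspace [set v | psi (X * q * v) = 0].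
  apply: (kerV (fun v => psi (X * q * v)) (cnorm (X * q) * cnorm (1 : A))) => [l y z|v].
    by rewrite !mulrDr -!scalerAr linearP.
  have := state_sandwich_le psi_state (X * q) 1 v.
  by rewrite mulr1.
apply: (factors_through_ideal_gen psi_state) => u v.
have dense := monomial_dense c_gt0 d_gt0 nicaT hgen.
move: u; apply: (dense _ (Vl v)) => k X mX; move: v; apply: (dense _ (Vr X)).
move=> l Y mY /=; rewrite (KMS_twist_defect mX mY) mulrA.
by rewrite (state_ideal0 psi_state) ?mulr0.
Qed.

End Defect.
End KMS.

Theorem corollary5p3 (R : realType) (c d : nat) (hc : (0 < c)%N) (hd : (0 < d)%N)
    (A : cstarAlgType R) (T : BS c d -> A) (hT : is_CGP T)
    (alpha : R -> {lrmorphism A -> A}) (halpha : is_dynamics T alpha)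
    (beta : R) :
  [/\ forall psi : {scalar A}, is_KMS T alpha beta psi ->
        factors_through (ideal_gen (1 - T BSb * star (T BSb))) psi,
      beta < ln d%:R ->
        ~ (exists psi : {scalar A}, is_KMS T alpha beta psi) &
      forall psi : {scalar A}, is_KMS T alpha beta psi ->
        (factors_through
           (ideal_gen (1 - \sum_(j < d)
              T (BSb ^+ j * BSa)%g * star (T (BSb ^+ j * BSa)%g))) psi
         <-> beta = ln d%:R)].
Proof.
have nT := CGP_nica hT.
pose x (j : 'I_d) : BS c d := (BSb ^+ j * BSa)%g.
have x_pos j : BSpos (x j) by exact: BSpos_bXa.
have orth_lt (i j : 'I_d) : (i < j)%N -> star (T (x i)) * T (x j) = 0.
  move=> ij; rewrite !nica_bXa // starM starX -mulrA.
  rewrite [star _ ^+ _ * _]mulrA (star_bX_bX nT) (ltnW ij) mulrA.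
  by rewrite (star_a_bXa hc hd nT) // subn_gt0 ij (leq_ltn_trans (leq_subr _ _)).
have x_orth i j : i != j -> star (T (x i)) * T (x j) = 0.
  rewrite -val_eqE neq_ltn => /orP[|ji]; first exact: orth_lt.
  by rewrite -[LHS]starK starM starK orth_lt // star0.
have d0 : 0 < d%:R :> R by rewrite ltr0n.
have defect psi : is_KMS T alpha beta psi ->
    psi (1 - \sum_j T (x j) * star (T (x j))) = (1 - d%:R * expR (- beta))%:C%C.
  move=> hpsi; rewrite (KMS_defect hT hpsi x_pos).
  rewrite (eq_bigr (fun=> (expR (- beta))%:C%C)); last first.
    by move=> j _; rewrite BStheta_bXa mulr1.
  by rewrite sumr_const card_ord rmorphB rmorphM rmorph1 rmorph_nat mulr_natl.
split.
- move=> psi hpsi; pose y (_ : 'I_1) : BS c d := BSb.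
  have y_pos j : BSpos (y j) by exact: BSpos_b.
  have y_orth i j : i != j -> star (T (y i)) * T (y j) = 0 by rewrite !ord1 eqxx.
  have := KMS_factors_defect hc hd hT hpsi y_pos y_orth.
  rewrite (KMS_defect hT hpsi y_pos) !big_ord1 BStheta_b mulr0 expR0.
  by rewrite subrr; exact.
- move=> beta_lt [psi hpsi]; have [[psi_ge0 _ _] _ _] := hpsi.
  have := psi_ge0 (1 - \sum_j T (x j) * star (T (x j))).
  rewrite (nica_defect_proj nT x_pos x_orth) (defect _ hpsi) lecR subr_ge0 expRN.
  rewrite ler_pdivrMr ?expR_gt0 // mul1r leNgt => /negP; apply.
  by rewrite -(lnK d0) ltr_expR.
- move=> psi hpsi; split=> [/factors_through_gen0|e].
    rewrite (defect _ hpsi) => -[/eqP].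
    rewrite subr_eq0 expRN eq_sym -(inj_eq (mulIf (lt0r_neq0 (expR_gt0 beta)))).
    by rewrite mul1r divfK ?lt0r_neq0 ?expR_gt0 // => /eqP e; rewrite e expRK.
  apply: (KMS_factors_defect hc hd hT hpsi x_pos x_orth).
  by rewrite (defect _ hpsi) e expRN lnK // divff ?gt_eqF // subrr.
Qed.
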